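(* Let $c\colon X\times Y\to[-\infty,+\infty]$ and $\underline c\colon\underline X\times\underline Y\to[-\infty,+\infty]$ define two cost spaces and let $P=(P_1,P_2)\colon (X\times Y,c)\to(\underline X\times\underline Y,\underline c)$ be a cost submersion. If $(X\times Y,c)$ is an NNCC space, then so is $(\underline X\times\underline Y,\underline c)$.
   Context: A cost space $(X\times Y,c)$ consists of two arbitrary sets $X,Y$ and an arbitrary function $c\colon X\times Y\to[-\infty,+\infty]$. Given a path $\mathrm x\colon[0,1]\to X$ (an arbitrary function; no continuity is required) and $\bar y\in Y$, the pair $(\mathrm x,\bar y)$ is a variational c-segment on $(X\times Y,c)$ if $c(\mathrm x(s),\bar y)$ is finite for all $s\in[0,1]$ and, for all $s\in(0,1)$ and all $y\in Y$, $$c(\mathrm x(s),\bar y)-c(\mathrm x(s),y)\le (1-s)[c(\mathrm x(0),\bar y)-c(\mathrm x(0),y)]+s[c(\mathrm x(1),\bar y)-c(\mathrm x(1),y)],$$ with the usual arithmetic in $[-\infty,+\infty]$ and the rule $(+\infty)+(-\infty)=(-\infty)+(+\infty)=+\infty$ in the right-hand side. $(X\times Y,c)$ is an NNCC space if for every $(x_0,x_1,\bar y)\in X\times X\times Y$ such that $c(x_0,\bar y)$ and $c(x_1,\bar y)$ are finite, there exists a variational c-segment $(\mathrm x,\bar y)$ with $\mathrm x(0)=x_0$, $\mathrm x(1)=x_1$. Cost submersion: let $P_1\colon X\to\underline X$ and $P_2\colon Y\to\underline Y$ be surjective maps. Write $x\sim x'$ if $P_1(x)=P_1(x')$ and $y\sim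 y'$ if $P_2(y)=P_2(y')$. The map $P(x,y)=(P_1(x),P_2(y))$ is a cost submersion if (1) for every $(x,y)\in X\times Y$, setting $(\underline x,\underline y)=P(x,y)$, $$\underline c(\underline x,\underline y)=\inf_{x'\sim x,\,y'\sim y}c(x',y')=\inf_{y'\sim y}c(x,y')=\inf_{x'\sim x}c(x',y);$$ and (2) all these infima are attained whenever $\underline c(\underline x,\underline y)$ is finite. *)

(* Defs.v *)
From mathcomp Require Import all_boot all_order all_algebra.
From mathcomp Require Import all_classical all_reals ereal.

Set Implicit Arguments.
Unset Strict Implicit.
Unset Printing Implicit Defensive.

Import Order.TTheory GRing.Theory Num.Theory.

Local Open Scope classical_set_scope.
Local Open Scope ring_scope.
Local Open Scope ereal_scope.

(* A path is any function on {i01 R}, the type of the elements of [0, 1].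
   In the right-hand side, ( _ + _ )%dE is the addition of \bar R for which
   (+oo) + (-oo) = (-oo) + (+oo) = +oo; the default one gives -oo instead.
   The other sums are never indeterminate, since c (x s, yb) is finite. *)
Definition variational_c_segment (R : realType) (X Y : Type)
    (c : X * Y -> \bar R) (x : {i01 R} -> X) (yb : Y) : Prop :=
  (forall s : {i01 R}, c (x s, yb) \is a fin_num) /\
  (forall (s : {i01 R}) (y : Y), (0 < s%:num < 1)%R ->
     c (x s, yb) - c (x s, y) <=
       ((1 - s%:num)%:E * (c (x 0%R%:i01, yb) - c (x 0%R%:i01, y))%E
        + (s%:num)%:E * (c (x 1%R%:i01, yb) - c (x 1%R%:i01, y))%E)%dE).

Definition NNCC_space (R : realType) (X Y : Type) (c : X * Y -> \bar R) : Prop :=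
  forall (x0 x1 : X) (yb : Y),
    c (x0, yb) \is a fin_num -> c (x1, yb) \is a fin_num ->
    exists x : {i01 R} -> X,
      [/\ variational_c_segment c x yb, x 0%R%:i01 = x0 & x 1%R%:i01 = x1].

Definition fiber (T U : Type) (f : T -> U) (t : T) : set T :=
  [set t' | f t' = f t].

Definition cost_submersion (R : realType) (X Y Xu Yu : Type)
    (c : X * Y -> \bar R) (cu : Xu * Yu -> \bar R)
    (P1 : X -> Xu) (P2 : Y -> Yu) : Prop :=
  [/\ set_surj [set: X] [set: Xu] P1,
      set_surj [set: Y] [set: Yu] P2 &
      forall (x : X) (y : Y),
        let cxy := [set c p | p in fiber P1 x `*` fiber P2 y] in
        let cy := [set c (x, y') | y' in fiber P2 y] in
        let cx := [set c (x', y) | x' in fiber P1 x] in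
        [/\ cu (P1 x, P2 y) = ereal_inf cxy,
            ereal_inf cxy = ereal_inf cy,
            ereal_inf cy = ereal_inf cx &
            cu (P1 x, P2 y) \is a fin_num ->
            [/\ cxy (ereal_inf cxy), cy (ereal_inf cy) & cx (ereal_inf cx)]]].

(* Main.v *)
Require Import Defs.
From mathcomp Require Import all_boot all_order all_algebra.
From mathcomp Require Import all_classical all_reals ereal.

(** A segment downstairs is obtained by projecting a segment upstairs.  Fix
    [yb] above the base point and lift the two endpoints to [x0], [x1] at which
    the infimum of [c (., yb)] over the fibers is attained, so that
    [c (xi, yb)] equals the projected cost; let [x] be a variational c-segment
    from [x0] to [x1].  In the segment inequality at [y], the terms
    [- c (xi, y)] on the right are at most the projected ones, so the right-hand
    side is bounded by its projected counterpart, which depends only on [P2 y].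
    Two uses of this bound finish the proof.

    When [y] lies over the same point as [yb], the bound is [0]: hence
    [c (x s, yb) <= c (x s, y)], so [yb] minimizes [c (x s, .)] on its fiber and
    the projected cost along [P1 \o x] equals [c (x s, yb)]
    ([segment_cost_minimal]).  This yields in particular the finiteness of the
    projected cost, which could a priori be [-oo] in the interior.  For an
    arbitrary fiber of [P2], taking the infimum of [c (x s, .)] over that fiber
    on the left-hand side gives the inequality downstairs; this passage to the
    infimum ([leeB_ereal_inf]) remains valid if the infimum is [-oo]. *)

Set Implicit Arguments.
Unset Strict Implicit.
Unset Printing Implicit Defensive.

Import Order.TTheory GRing.Theory Num.Theory.

Local Open Scope classical_set_scope.
Local Open Scope ring_scope.
Local Open Scope ereal_scope.

(** Only [a] has to be finite: if [z = -oo] both sides say that [b = +oo], if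
    [z = +oo] both are true, and the roles of [z] and [b] are symmetric. *)
Lemma leeB_swap (R : realType) (a z b : \bar R) :
  a \is a fin_num -> (a - z <= b) = (a - b <= z).
Proof.
case: a => [r| |] // _; case: z => [z| |]; case: b => [b| |] //=.
- by rewrite -!EFinB !lee_fin lerBlDr lerBlDl.
- by rewrite /= leey leNye.
- by rewrite /= leey leNye.
Qed.

Lemma leeB_ereal_inf (R : realType) (a b : \bar R) (S : set (\bar R)) :
  a \is a fin_num -> (forall z, S z -> a - z <= b) -> a - ereal_inf S <= b.
Proof.
move=> afin aS; rewrite leeB_swap //; apply/le_ereal_inf_tmp => z Sz.
by rewrite -leeB_swap //; exact: aS.
Qed.

Section Submersion.
Variables (R : realType) (X Y Xu Yu : Type).
Variables (c : X * Y -> \bar R) (cu : Xu * Yu -> \bar R).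
Variables (P1 : X -> Xu) (P2 : Y -> Yu).
Hypothesis subm : cost_submersion c cu P1 P2.

Lemma submersion_costE (x : X) (y : Y) :
  cu (P1 x, P2 y) = ereal_inf [set c (x, y') | y' in fiber P2 y].
Proof. by have [_ _ /(_ x y) [-> ->]] := subm. Qed.

Lemma submersion_cost_le (x : X) (y : Y) : cu (P1 x, P2 y) <= c (x, y).
Proof. by rewrite submersion_costE; apply: ereal_inf_lbound; exists y. Qed.

Lemma submersion_lift_base (y : Yu) : exists y', P2 y' = y.
Proof. by have [_ /(_ y I) [y' _ <-] _] := subm; exists y'. Qed.

Lemma submersion_lift (x : Xu) (y : Y) : cu (x, P2 y) \is a fin_num ->
  exists2 x', P1 x' = x & c (x', y) = cu (x, P2 y).
Proof.
have [/(_ x I) [x' _ <-] _ /(_ x' y) [E1 E2 E3 att]] := subm.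
by move=> /att[_ _ [x'' Px'' cx'']]; exists x''; rewrite // cx'' -E3 -E2 -E1.
Qed.

Section Segment.
Variables (x : {i01 R} -> X) (yb : Y).
Hypothesis xseg : variational_c_segment c x yb.
Hypothesis x0min : c (x 0%R%:i01, yb) = cu (P1 (x 0%R%:i01), P2 yb).
Hypothesis x1min : c (x 1%R%:i01, yb) = cu (P1 (x 1%R%:i01), P2 yb).

(** The right-hand side sees [y] only through [P2 y], so that the infimum over
    a fiber of [P2] can be taken on the left alone. *)
Lemma segment_projected_bound (s : {i01 R}) (y : Y) : (0 < s%:num < 1)%R ->
  c (x s, yb) - c (x s, y) <=
    ((1 - s%:num)%:E * (cu (P1 (x 0%R%:i01), P2 yb)
                        - cu (P1 (x 0%R%:i01), P2 y))%E
     + (s%:num)%:E * (cu (P1 (x 1%R%:i01), P2 yb)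
                      - cu (P1 (x 1%R%:i01), P2 y))%E)%dE.
Proof.
move=> s01; have [s0 s1] := andP s01.
apply: (le_trans (xseg.2 s y s01)); rewrite x0min x1min.
apply: DualAddTheoryRealDomain.lee_dD; apply: lee_wpmul2l;
  rewrite ?lee_fin ?subr_ge0 ?(ltW s0) ?(ltW s1) //;
  by apply: leeB => //; exact: submersion_cost_le.
Qed.

(** For [y] in the fiber of [yb] the projected bound vanishes, so interior
    points of the segment inherit from the endpoints that [yb] minimizes the
    cost on its fiber. *)
Lemma segment_cost_minimal (s : {i01 R}) :
  cu (P1 (x s), P2 yb) = c (x s, yb).
Proof.
have [s0|s0] := eqVneq s%:num 0%R.
  by have -> : s = 0%R%:i01 by [exact: val_inj]; rewrite x0min.
have [s1|s1] := eqVneq s%:num 1%R.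
  by have -> : s = 1%R%:i01 by [exact: val_inj]; rewrite x1min.
have s01 : (0 < s%:num < 1)%R.
  by rewrite !lt_neqAle eq_sym s0 s1 /=; apply/andP; split.
apply/le_anti; rewrite submersion_cost_le /= submersion_costE.
apply/le_ereal_inf_tmp => _ [y yby <-].
have := segment_projected_bound y s01.
rewrite yby -x0min -x1min !subee ?xseg.1 // !mule0 /=.
rewrite DualAddTheoryNumDomain.dadde0.
by rewrite leeB_swap ?xseg.1 // sube0.
Qed.

Lemma submersion_segment : variational_c_segment cu (P1 \o x) (P2 yb).
Proof.
split=> [s|s yu s01] /=; first by rewrite segment_cost_minimal xseg.1.
have [y <-] := submersion_lift_base yu.
rewrite segment_cost_minimal (submersion_costE (x s)).
apply: leeB_ereal_inf; first exact: xseg.1.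
by move=> _ [y' yy' <-]; rewrite -yy'; exact: segment_projected_bound.
Qed.

End Segment.
End Submersion.

Theorem proposition1p2 (R : realType) (X Y Xu Yu : Type)
    (c : X * Y -> \bar R) (cu : Xu * Yu -> \bar R)
    (P1 : X -> Xu) (P2 : Y -> Yu) :
  cost_submersion c cu P1 P2 -> NNCC_space c -> NNCC_space cu.
Proof.
move=> subm nncc xu0 xu1 yu.
have [yb <-] := submersion_lift_base subm yu => fin0 fin1.
have [x0 Px0 cx0] := submersion_lift subm fin0.
have [x1 Px1 cx1] := submersion_lift subm fin1.
have [||x [xseg xx0 xx1]] := nncc x0 x1 yb; rewrite ?cx0 ?cx1 //.
exists (P1 \o x); split; rewrite /= ?xx0 ?xx1 //.
by apply: (submersion_segment subm xseg); rewrite ?xx0 ?xx1 ?Px0 ?Px1.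
Qed.
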